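(* Let $\mathcal{A}$ be a labeling automaton over $\Sigma$. The ideals of $(\Sigma^*,\preceq_{\mathcal{A}})$ are precisely the sets of the form $\downarrow_{\preceq_\mathcal{A}}(u_0v_1^*u_1\cdots v_n^*u_n)$, where $u_0v_1u_1\cdots v_nu_n$ is a loop pattern for $\mathcal{A}$.
   Context: A finite automaton $\mathcal{A}=(Q,\Sigma,E,I,F)$ with $E\subseteq Q\times\Sigma\times Q$ is a labeling automaton if every word $w\in\Sigma^*$ has exactly one run of $\mathcal{A}$ (starting in an initial and ending in a final state). Define $u\preceq_\mathcal{A} v$ iff $v$ can be written as $v=u_0v_1u_1\cdots v_nu_n$ with $u=u_0u_1\cdots u_n$ such that the run of $\mathcal{A}$ on $v$ is in the same state before and after reading each $v_i$. A loop pattern for $\mathcal{A}$ is a word $w=u_0v_1u_1\cdots v_nu_n$ together with this decomposition ($u_i,v_i\in\Sigma^*$) such that the run of $\mathcal{A}$ on $w$ is in the same state before and after each $v_i$. An ideal of a WQO is a nonempty, downward closed, directed subset; $\downarrow_\preceq S=\{x\mid \exists s\in S: x\preceq s\}$. *)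

(* Defs.v *)
From mathcomp Require Import all_boot.
Set Implicit Arguments. Unset Strict Implicit. Unset Printing Implicit Defensive.

Record automaton (Sigma Q : finType) := Automaton {
  trans : Q -> Sigma -> Q -> bool;
  init  : pred Q;
  final : pred Q }.

Section Auto.
Variables (Sigma Q : finType) (A : automaton Sigma Q).

Fixpoint is_path (q : Q) (w : seq Sigma) (rs : seq Q) : bool :=
  match w, rs with
  | [::], [::] => true
  | a :: w', q' :: rs' => trans A q a q' && is_path q' w' rs'
  | _, _ => false
  end.

(* An accepting run of A on w: the state sequence q :: rs
   (state at position k, i.e. before reading letter k, is nth q (q::rs) k). *)
Definition accepting_run (q : Q) (rs : seq Q) (w : seq Sigma) : bool :=
  [&& init A q, is_path q w rs & final A (last q rs)].

Definition labeling : Prop :=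
  forall w : seq Sigma, exists! p : Q * seq Q, accepting_run p.1 p.2 w.

(* A decomposition u_0 v_1 u_1 ... v_n u_n is represented as
   (u_0, [:: (v_1,u_1); ...; (v_n,u_n)]). *)
Definition pattern := (seq Sigma * seq (seq Sigma * seq Sigma))%type.

Definition pat_word (p : pattern) : seq Sigma :=
  p.1 ++ flatten [seq vu.1 ++ vu.2 | vu <- p.2].

Definition pat_erase (p : pattern) : seq Sigma :=
  p.1 ++ flatten [seq vu.2 | vu <- p.2].

(* position (in pat_word p) just before v_{i+1} *)
Definition pat_start (p : pattern) (i : nat) : nat :=
  size (p.1 ++ flatten [seq vu.1 ++ vu.2 | vu <- take i p.2]).

Definition loops_ok (p : pattern) (q : Q) (rs : seq Q) : Prop :=
  forall i, i < size p.2 ->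
    nth q (q :: rs) (pat_start p i)
    = nth q (q :: rs) (pat_start p i + size (nth ([::], [::]) p.2 i).1).

Definition loop_pattern (p : pattern) : Prop :=
  exists q rs, accepting_run q rs (pat_word p) /\ loops_ok p q rs.

Definition preceq (u v : seq Sigma) : Prop :=
  exists p : pattern, pat_erase p = u /\ pat_word p = v /\ loop_pattern p.

Definition pat_lang (p : pattern) (w : seq Sigma) : Prop :=
  exists ks : seq nat, size ks = size p.2 /\
    w = p.1 ++ flatten [seq flatten (nseq kvu.1 kvu.2.1) ++ kvu.2.2
                       | kvu <- zip ks p.2].

Definition down (S : seq Sigma -> Prop) (x : seq Sigma) : Prop :=
  exists s, S s /\ preceq x s.

Definition ideal (S : seq Sigma -> Prop) : Prop :=
  [/\ exists x, S x,
      (forall x y, S y -> preceq x y -> S x) &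
      (forall x y, S x -> S y -> exists z, [/\ S z, preceq x z & preceq y z])].

End Auto.

(* Main.v *)
Require Import Defs.
From mathcomp Require Import all_boot.
From Stdlib Require Import Classical ClassicalEpsilon.

(** A run is a word over the finite alphabet of transitions. If two runs have
    the same endpoints, every embedding of one into the other as a subsequence
    skips only loops, because each matched transition fixes the current state;
    so [preceq] is the subsequence order on runs with equal endpoints, and
    proper inclusion of subsequence-closed sets is well founded by Higman's
    lemma.

    Let X be an ideal of runs from p to q, and let v be a loop at p with
    v X <= X containing every transition of every such loop. By directedness,
    either all runs in X use only transitions of v, and X is the closure of
    v^* x for any x in X; or there is one transition e outside v such that
    cofinally many runs of X read y e z with y over v. Then X is the closure of
    v^* y e X', where X' collects the tails z. If X' had the same
    subsequence closure as X, some loop through e could be pumped in X, against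
    the choice of v; so the argument recurses on X'. *)

Set Implicit Arguments.
Unset Strict Implicit.
Unset Printing Implicit Defensive.

(** * Increasing sequences of indices *)

Lemma extract_chain (R : nat -> nat -> Prop) :
  (forall n, exists2 m, n < m & R n m) ->
  exists g : nat -> nat, forall i, g i < g i.+1 /\ R (g i) (g i.+1).
Proof.
move=> H.
have H' n : exists m, n < m /\ R n m by have [m] := H n; exists m.
pose next n := sval (constructive_indefinite_description _ (H' n)).
exists (fun i => iter i next 0) => i /=.
exact: svalP (constructive_indefinite_description _ (H' _)).
Qed.

Lemma chain_lt (g : nat -> nat) :
  (forall i, g i < g i.+1) -> forall i j, i < j -> g i < g j.
Proof.
move=> gS; apply: (@homo_ltn _ g (fun a b => a < b)) => // y x z.
exact: ltn_trans.
Qed.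

(** * Higman's lemma *)

Section SubsequenceOrder.
Variable T : finType.
Implicit Types (x y z w : seq T) (L : seq T -> Prop).

(** An infinite ascending subsequence is required rather than one ascending pair, so that several
    refinements can be performed in succession. *)
Definition perfect L := forall f : nat -> seq T, (forall n, L (f n)) ->
  exists2 g : nat -> nat, (forall i j, i < j -> g i < g j)
    & (forall i j, i < j -> subseq (f (g i)) (f (g j))).

Lemma perfectS L L' : (forall x, L x -> L' x) -> perfect L' -> perfect L.
Proof. by move=> LL' pL f Lf; apply: pL => n; apply: LL'. Qed.

Lemma perfect_shift L (f : nat -> seq T) (h : nat -> nat) :
  perfect L -> (forall i j, i < j -> h i < h j) -> (forall n, L (f (h n))) ->
  exists2 g : nat -> nat, (forall i j, i < j -> g i < g j)
    & (forall i j, i < j -> subseq (f (g i)) (f (g j))).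
Proof.
move=> pL hlt Lfh; have [g glt fg] := pL (fun n => f (h n)) Lfh.
by exists (fun i => h (g i)) => i j ij; [apply/hlt/glt | apply: fg].
Qed.

(** Either infinitely many terms lie in [L1], or all terms from some index on lie in [L2]. *)
Lemma perfectU L1 L2 : perfect L1 -> perfect L2 ->
  perfect (fun x => L1 x \/ L2 x).
Proof.
move=> p1 p2 f Lf.
case: (classic (forall n, exists2 m, n < m & L1 (f m))) => [/extract_chain[g gP]|].
  (* Membership in [L1] is known at the end of each step of the chain, so the index starts at
     [g 1]. *)
  apply: (perfect_shift (h := fun i => g i.+1) p1).
    by move=> i j ij; apply: chain_lt => // k; case: (gP k).
  by move=> n; case: (gP n).
move=> /not_all_ex_not[n nP].
apply: (perfect_shift (h := fun i => n.+1 + i) p2).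
  by move=> i j; rewrite ltn_add2l.
move=> i; case: (Lf (n.+1 + i)) => // L1f; case: nP.
by exists (n.+1 + i) => //; rewrite addSn ltnS leq_addr.
Qed.

(** Refine first along the prefixes, then along the suffixes of the subsequence found. *)
Lemma perfect_cat_cons L1 L2 (a : T) : perfect L1 -> perfect L2 ->
  perfect (fun x => exists y z, [/\ x = y ++ a :: z, L1 y & L2 z]).
Proof.
move=> p1 p2 f Lf.
have Lf' n : exists yz, [/\ f n = yz.1 ++ a :: yz.2, L1 yz.1 & L2 yz.2].
  by have [y [z ?]] := Lf n; exists (y, z).
pose yz n := sval (constructive_indefinite_description _ (Lf' n)).
have yzP n : [/\ f n = (yz n).1 ++ a :: (yz n).2, L1 (yz n).1 & L2 (yz n).2].
  exact: svalP (constructive_indefinite_description _ (Lf' n)).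
have [g glt gP] := p1 (fun n => (yz n).1) (fun n => let: And3 _ h _ := yzP n in h).
have [h hlt hP] := p2 (fun n => (yz (g n)).2) (fun n => let: And3 _ _ h := yzP (g n) in h).
exists (fun i => g (h i)) => i j ij; first exact/glt/hlt.
have [-> _ _] := yzP (g (h i)); have [-> _ _] := yzP (g (h j)).
by apply: cat_subseq; [apply/gP/hlt | rewrite /= eqxx; apply: hP].
Qed.

Lemma has_split (a : pred T) x : has a x ->
  exists y b z, [/\ x = y ++ b :: z, ~~ has a y & a b].
Proof.
by case/split_find=> b y z ab ay; exists y, b, z; rewrite cat_rcons.
Qed.

(* Cutting a word that avoids [a :: w] at its first [a] leaves a prefix over a
   smaller alphabet and a suffix that avoids [w]. *)
Lemma perfect_avoid (A : {set T}) w : {subset w <= A} ->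
  (forall a, a \in A -> perfect (fun x => {subset x <= A :\ a})) ->
  perfect (fun x => {subset x <= A} /\ ~~ subseq w x).
Proof.
elim: w => [_ _ f Lf | a w IH wA smaller].
  by have [_] := Lf 0; rewrite sub0seq.
have aA : a \in A by apply: wA; rewrite mem_head.
have pa := smaller a aA.
have wA' : {subset w <= A} by move=> b bw; apply: wA; rewrite inE bw orbT.
apply: perfectS (perfectU pa (perfect_cat_cons (a := a) pa (IH wA' smaller))).
move=> x [xA wx]; case: (boolP (a \in x)) => [| ax].
  rewrite -has_pred1 => /has_split[y [b [z [def_x yb /eqP Eb]]]].
  move: yb; rewrite has_pred1 => ay; rewrite {b}Eb in def_x.
  right; exists y, z; split=> //.
    move=> b yb; rewrite !inE xA ?andbT; last by rewrite def_x mem_cat yb.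
    by apply: contraNneq ay => <-.
  split=> [b zb|]; first by apply: xA; rewrite def_x mem_cat inE zb !orbT.
  apply: contra wx => wz; rewrite def_x.
  by rewrite -[a :: w]cat0s; apply: cat_subseq; rewrite ?sub0seq //= eqxx.
by left=> b xb; rewrite !inE xA // andbT; apply: contraNneq ax => <-.
Qed.

(** Induction on the size of the alphabet. Either each term embeds in a later one, and these
    embeddings chain, or some term embeds in no later one, and the tail after it avoids a fixed
    word. *)
Theorem higman : perfect (fun=> True).
Proof.
suff H n : forall A : {set T}, #|A| <= n -> perfect (fun x => {subset x <= A}).
  by apply: perfectS (H _ [set: T] (leqnn _)) => x _ a; rewrite inE.
elim: n => [A | n IH A An].
  rewrite leqn0 cards_eq0 => /eqP-> f fP.
  have f0 n : f n = [::].
    by case: (f n) (fP n) => // a x /(_ a); rewrite mem_head inE => /(_ isT).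
  by exists id => // i j _; rewrite !f0.
move=> f fA.
case: (classic (forall n, exists2 m, n < m & subseq (f n) (f m))).
  move=> /extract_chain[g gP]; exists g.
    by apply: chain_lt => i; case: (gP i).
  move=> i j; apply: (@homo_ltn _ g (fun a b => subseq (f a) (f b))).
    by move=> y x z; apply: subseq_trans.
  by move=> k; case: (gP k).
move=> /not_all_ex_not[m mP].
apply: (perfect_shift (h := fun i => m.+1 + i) (perfect_avoid (fA m) _)).
- by move=> a aA; apply: IH; rewrite -ltnS (leq_trans _ An) // (cardsD1 a A) aA.
- by move=> i j; rewrite ltn_add2l.
move=> i; split=> //; apply/negP => sub; case: mP.
by exists (m.+1 + i) => //; rewrite addSn ltnS leq_addr.
Qed.

(** * Well-foundedness of inclusion of subsequence-closed sets *)

Definition subseq_closed L := forall x y, L y -> subseq x y -> L x.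

Definition proper_downset L' L :=
  [/\ subseq_closed L', (forall x, L' x -> L x) & exists2 x, L x & ~ L' x].

(** Along a descending chain [F], choose [f i] in [F i] outside [F i.+1]. Higman's lemma embeds some
    [f i] in a later [f j], which lies in [F i.+1]; closure then puts [f i] there as well. *)
Lemma proper_downset_wf : well_founded proper_downset.
Proof.
move=> L; apply: NNPP => nacc.
have step (K : {K | ~ Acc proper_downset K}) :
    exists K' : {K | ~ Acc proper_downset K}, proper_downset (sval K') (sval K).
  case: K => K nK /=; apply: NNPP => H; apply: nK; constructor=> K' K'K.
  by apply: NNPP => nK'; apply: H; exists (exist _ K' nK').
pose next K := sval (constructive_indefinite_description _ (step K)).
have nextP K : proper_downset (sval (next K)) (sval K).
  exact: svalP (constructive_indefinite_description _ (step K)).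
pose F i := sval (iter i next (exist _ L nacc)).
have FS i : proper_downset (F i.+1) (F i) by apply: nextP.
have Fle i j : i <= j -> forall x, F j x -> F i x.
  move=> ij x; rewrite -(subnK ij); elim: (j - i) => // k IH; rewrite addSn.
  by case: (FS (k + i)) => _ sub _ /sub.
have Fx i : exists x, F i x /\ ~ F i.+1 x by case: (FS i) => _ _ [x]; exists x.
pose f i := sval (constructive_indefinite_description _ (Fx i)).
have fP i : F i (f i) /\ ~ F i.+1 (f i).
  exact: svalP (constructive_indefinite_description _ (Fx i)).
have [g glt gP] := higman (f := f) (fun=> I).
case: (fP (g 0)) => _; apply; case: (FS (g 0)) => cl _ _.
apply: cl (gP 0 1 isT); apply: Fle (proj1 (fP (g 1))); exact: glt.
Qed.

(** * Embeddings, powers and directed sets *)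

Lemma subseq_consP (a : T) x y : subseq (a :: x) y ->
  exists y1 y2, y = y1 ++ a :: y2 /\ subseq x y2.
Proof.
elim: y => //= b y IH; case: eqP => [<- | _ /IH[y1 [y2 [-> ?]]]].
  by exists [::], y.
by exists (b :: y1), y2.
Qed.

(** As [y'] is free of [a], the displayed [a] on the left is matched no earlier than the displayed
    [a] on the right. *)
Lemma subseq_after_first (a : T) y z y' z' : a \notin y' ->
  subseq (y ++ a :: z) (y' ++ a :: z') -> subseq z z'.
Proof.
move=> ay' /(subseq_trans (suffix_subseq y (a :: z))).
elim: y' ay' => /= [_ | b y' IH]; first by rewrite eqxx.
by rewrite inE negb_or => /andP[/negPf-> /IH].
Qed.

(** Each copy of [y] supplies one letter of [x]. *)
Lemma subset_subseq_pow x y : {subset x <= y} ->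
  subseq x (flatten (nseq (size x) y)).
Proof.
elim: x => //= a x IH xy; rewrite -cat1s; apply: cat_subseq.
  by rewrite sub1seq xy ?mem_head.
by apply: IH => b xb; rewrite xy // inE xb orbT.
Qed.

Lemma subseq_pow m n x : m <= n ->
  subseq (flatten (nseq m x)) (flatten (nseq n x)).
Proof.
move=> mn; rewrite -(subnKC mn) nseqD flatten_cat; exact: prefix_subseq.
Qed.

Definition directed L := forall x y, L x -> L y ->
  exists z, [/\ L z, subseq x z & subseq y z].

(** If each [P c] failed somewhere in [L], a common upper bound of these finitely many failures
    would violate every [P c], since failure passes upwards. *)
Lemma directed_pigeonhole (C : finType) L (P : C -> seq T -> Prop) :
  (exists x, L x) -> directed L ->
  (forall c x y, L x -> subseq x y -> P c y -> P c x) ->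
  (forall x, L x -> exists c, P c x) ->
  exists c, forall x, L x -> P c x.
Proof.
move=> [x0 Lx0] dirL antiP LP; apply: NNPP => none.
have H (s : seq C) : exists2 x, L x & forall c, c \in s -> ~ P c x.
  elim: s => [|c s [x Lx xP]]; first by exists x0.
  have [y Ly Pcy] : exists2 y, L y & ~ P c y.
    apply: NNPP => H; apply: none; exists c => y Ly.
    by apply: NNPP => nP; apply: H; exists y.
  have [z [Lz xz yz]] := dirL _ _ Lx Ly; exists z => // d.
  rewrite inE => /orP[/eqP-> | ds] Pz; first exact: Pcy (antiP _ _ _ Ly yz Pz).
  exact: xP ds (antiP _ _ _ Lx xz Pz).
have [x Lx xP] := H (enum C).
by have [c] := LP x Lx; apply: xP; rewrite mem_enum.
Qed.

End SubsequenceOrder.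

Definition pow (T : Type) n (v : seq T) := flatten (nseq n v).

(** * Languages of patterns *)

Section PatternLanguages.
Variable T : finType.
Implicit Types (u v y z : seq T) (l : seq (seq T * seq T)) (P : pattern T).

Lemma pat_lang_nil u y : pat_lang (u, [::]) y <-> y = u.
Proof.
split=> [[[|k ks] [// _ ->]] | ->]; first by rewrite cats0.
by exists [::]; rewrite /= cats0.
Qed.

Lemma pat_lang_cons u v u' l y : pat_lang (u, (v, u') :: l) y <->
  exists n z, pat_lang (u', l) z /\ y = u ++ pow n v ++ z.
Proof.
split=> [[[|k ks] [//= [Eks] ->]] | [n [z [[ks [Eks ->]] ->]]]].
  by exists k, (u' ++ flatten [seq pow kvu.1 kvu.2.1 ++ kvu.2.2 | kvu <- zip ks l]);
    split; [exists ks | rewrite !catA].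
by exists (n :: ks); rewrite /= Eks !catA.
Qed.

Lemma pat_lang_catl u u' l y : pat_lang (u ++ u', l) y <->
  exists z, pat_lang (u', l) z /\ y = u ++ z.
Proof.
split=> [[ks [Eks ->]] | [z [[ks [Eks ->]] ->]]].
  by eexists; split; [exists ks | rewrite -catA].
by exists ks; rewrite -catA.
Qed.

(** The pointwise maximum of the two exponent sequences gives an upper bound. *)
Lemma pat_lang_directed P : directed (pat_lang P).
Proof.
case: P => u l; elim: l u => [|[v u'] l IH] u y1 y2.
  by move=> /pat_lang_nil-> /pat_lang_nil->; exists u; split=> //; apply/pat_lang_nil.
move=> /pat_lang_cons[n1 [z1 [/IH H ->]]] /pat_lang_cons[n2 [z2 [/H[z [lz z1z z2z] ->]]]].
exists (u ++ pow (maxn n1 n2) v ++ z); split; first by apply/pat_lang_cons; exists (maxn n1 n2), z.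
  by do 2 apply: cat_subseq => //; apply: subseq_pow; apply: leq_maxl.
by do 2 apply: cat_subseq => //; apply: subseq_pow; apply: leq_maxr.
Qed.

Lemma pat_lang_inhabited P : exists y, pat_lang P y.
Proof. by eexists; exists (nseq (size P.2) 0); rewrite size_nseq. Qed.

End PatternLanguages.

(** * Runs as words of transitions *)

Section Runs.
Variables (Sigma Q : finType) (A : automaton Sigma Q).
(** Source [e.1.1], letter [e.1.2] and target [e.2]. *)
Let edge := (Q * Sigma * Q)%type.
Implicit Types (p q r : Q) (e : edge) (x y z v w : seq edge).
Implicit Types (X : seq edge -> Prop) (P : pattern edge).

Definition target p x := last p [seq e.2 | e <- x].

Fixpoint walk p x : bool :=
  if x is e :: x' then [&& e.1.1 == p, trans A p e.1.2 e.2 & walk e.2 x']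
  else true.

Definition run p q x := walk p x && (target p x == q).

Lemma target_cat p x y : target p (x ++ y) = target (target p x) y.
Proof. by rewrite /target map_cat last_cat. Qed.

Lemma walk_cat p x y : walk p (x ++ y) = walk p x && walk (target p x) y.
Proof. by elim: x p => //= e x IH p; rewrite IH !andbA. Qed.

Lemma run_cat p q r x y : run p q x -> run q r y -> run p r (x ++ y).
Proof.
by rewrite /run walk_cat target_cat => /andP[-> /eqP->] /andP[-> /eqP->] /=.
Qed.

Lemma run_catP p r x y :
  run p r (x ++ y) -> run p (target p x) x /\ run (target p x) r y.
Proof.
by rewrite /run walk_cat target_cat -andbA => /and3P[-> -> ->]; rewrite eqxx.
Qed.

Lemma run_nil p q : run p q [::] = (p == q).
Proof. by []. Qed.

Lemma run_cons p q e x :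
  run p q (e :: x) = [&& e.1.1 == p, trans A p e.1.2 e.2 & run e.2 q x].
Proof. by rewrite /run /= -!andbA. Qed.

Lemma run_target p q q' x : run p q x -> run p q' x -> q = q'.
Proof. by move=> /andP[_ /eqP<-] /andP[_ /eqP<-]. Qed.

Lemma run_cat_cons p q x e y : run p q (x ++ e :: y) ->
  [/\ run p e.1.1 x, run e.1.1 e.2 [:: e] & run e.2 q y].
Proof.
move=> /run_catP[rx]; rewrite run_cons => /and3P[/eqP Ee tr ry].
by rewrite run_cons ry Ee rx eqxx tr run_nil eqxx.
Qed.

Lemma run_pow p n v : run p p v -> run p p (pow n v).
Proof.
by move=> rv; elim: n => [|n IH]; [rewrite run_nil | apply: run_cat rv IH].
Qed.

(** * Ideals of runs and pumpable loops *)

(** Downward closure is required only among runs from [p] to [q]; other subsequences of members may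
    lie outside [X]. *)
Definition ideal_of_runs p q X :=
  [/\ exists x, X x, forall x, X x -> run p q x,
      forall x y, X y -> run p q x -> subseq x y -> X x & directed X].

Definition pumpable p X v := run p p v /\ forall x, X x -> X (v ++ x).

Lemma pumpable_pow p X v n x : pumpable p X v -> X x -> X (pow n v ++ x).
Proof.
by move=> [_ Xv] Xx; elim: n => //= n IH; rewrite /pow /= -catA; apply: Xv.
Qed.

(* The loops may depend on the run, but by directedness they can be taken with
   one common set of edges, and loops with the same edges embed into
   concatenations of one another. *)
Lemma uniform_pumpable p q X e : ideal_of_runs p q X ->
  (forall x, X x -> exists v, [/\ run p p v, e \in v & X (v ++ x)]) ->
  exists2 v, pumpable p X v & e \in v.
Proof.
move=> [X0 Xrun Xdown Xdir] Xloop.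
pose F (G : {set edge}) x := exists v,
  [/\ run p p v, e \in v, [set a in v] = G & X (v ++ x)].
have [G GP] : exists G, forall x, X x -> F G x.
  apply: directed_pigeonhole => // [G x y Xx xy [v [rv ev vG Xvy]]|x /Xloop[v [rv ev Xvx]]].
    exists v; split=> //; apply: Xdown Xvy _ (cat_subseq (subseq_refl v) xy).
    exact: run_cat rv (Xrun _ Xx).
  by exists [set a in v], v.
have [x0 Xx0] := X0; have [v [rv ev vG _]] := GP _ Xx0.
exists v => //; split=> // x Xx.
have [u [vu Xux]] : exists u, subseq v u /\ X (u ++ x).
  have: {subset v <= G} by move=> a; rewrite -vG inE.
  move: v {rv ev vG} => v; elim: v => [_|a v IH vG]; first by exists [::].
  have [|u [vu Xux]] := IH; first by move=> b bv; rewrite vG // inE bv orbT.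
  have [w [rw ew wG Xw]] := GP _ Xux; exists (w ++ u); split; last by rewrite -catA.
  rewrite -cat1s; apply: cat_subseq => //; rewrite sub1seq.
  by have := vG a (mem_head _ _); rewrite -wG inE.
apply: Xdown Xux (run_cat rv (Xrun _ Xx)) (cat_subseq vu (subseq_refl x)).
Qed.

(** Pumpable loops compose and there are finitely many edges: concatenate one loop for each edge
    that occurs in a pumpable loop. *)
Lemma maximal_pumpable p X : exists2 v, pumpable p X v &
  forall v', pumpable p X v' -> {subset v' <= v}.
Proof.
have H (s : seq edge) : exists2 v, pumpable p X v &
    forall e, e \in s -> forall v', pumpable p X v' -> e \in v' -> e \in v.
  elim: s => [|e s [v [rv Xv] vP]].
    by exists [::] => //; split=> //; rewrite run_nil.
  case: (classic (exists2 v', pumpable p X v' & e \in v')) => [[v' [rv' Xv'] ev']|no].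
    exists (v' ++ v); first split; first exact: run_cat rv' rv.
      by move=> x /Xv/Xv'; rewrite catA.
    move=> a; rewrite inE mem_cat => /orP[/eqP-> | sa w pw aw].
      by rewrite ev'.
    by rewrite (vP a sa w pw aw) orbT.
  exists v => // a; rewrite inE => /orP[/eqP-> | sa] w pw aw; last exact: vP pw aw.
  by case: no; exists w.
have [v pv vP] := H (enum {: edge}); exists v => // v' pv' e ev'.
by apply: vP pv' ev'; rewrite mem_enum.
Qed.

(** * Patterns of runs and the decomposition of ideals *)

(** Here [r] is the state before [v]; as [v] returns to it, the following [u] starts from [r]
    again. *)
Fixpoint looped r (l : seq (seq edge * seq edge)) :=
  if l is (v, u) :: l' then (target r v == r) && looped (target r u) l'
  else true.

Definition run_pattern p q P :=
  run p q (pat_word P) && looped (target p P.1) P.2.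

Lemma run_pat_lang p q P y : run_pattern p q P -> pat_lang P y -> run p q y.
Proof.
case: P => u l; elim: l u p y => [|[v u'] l IH] u p y.
  by rewrite /run_pattern /= /pat_word /= cats0 andbT => ru /pat_lang_nil->.
move=> /andP[]; rewrite /pat_word /= => /run_catP[ru].
rewrite -catA => /run_catP[rv rl] /andP[/eqP Ev lo] /pat_lang_cons[n [z [lz ->]]].
rewrite Ev in rv rl; apply: run_cat ru (run_cat (run_pow n rv) _).
by apply: IH lz; rewrite /run_pattern rl.
Qed.


(* In a decomposition of a run at its first transition [e] outside [v], this is
   the set of tails; since [e] is outside [v], embeddings restrict to tails. *)
Definition residual X v e z := exists y,
  {subset y <= v} /\ X (y ++ e :: z).

(** For directedness, an upper bound in [X] of two runs [y1 ++ e :: z1] and [y2 ++ e :: z2] embeds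
    in some [y ++ e :: z] of [X] with [e] not in [y], so both tails embed in [z]. *)
Lemma ideal_residual p q X v e : ideal_of_runs p q X -> e \notin v ->
  (forall x, X x -> exists y z,
     [/\ {subset y <= v}, X (y ++ e :: z) & subseq x (y ++ e :: z)]) ->
  ideal_of_runs e.2 q (residual X v e).
Proof.
move=> [[x0 Xx0] Xrun Xdown Xdir] ev XF; split.
- by have [y [z [yv Xyz _]]] := XF _ Xx0; exists z, y.
- by move=> z [y [_ /Xrun/run_cat_cons[]]].
- move=> z0 z [y [yv Xyz]] rz0 z0z; exists y; split=> //.
  have [ry re _] := run_cat_cons (Xrun _ Xyz).
  apply: Xdown Xyz (run_cat ry (run_cat re rz0)) _.
  by apply: cat_subseq => //=; rewrite eqxx.
move=> z1 z2 [y1 [_ X1]] [y2 [_ X2]].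
have [x [Xx x1 x2]] := Xdir _ _ X1 X2; have [y [z [yv Xyz xyz]]] := XF _ Xx.
have ey : e \notin y by apply: contra ev => /yv.
exists z; split; first by exists y.
  exact: subseq_after_first ey (subseq_trans x1 xyz).
exact: subseq_after_first ey (subseq_trans x2 xyz).
Qed.

Lemma ideal_of_runs_pattern p q X : ideal_of_runs p q X ->
  exists P, run_pattern p q P /\
    forall x, X x <-> run p q x /\ exists y, pat_lang P y /\ subseq x y.
Proof.
pose closure X x := exists2 y, X y & subseq x y.
(* The induction runs on the subsequence closure, since [X] is closed only among runs and the start
   state changes in the recursion. *)
move: {2}(closure X) (erefl (closure X)) => J.
elim/(well_founded_ind (@proper_downset_wf edge)): J p X => J IH p X defJ idX.
have [[x0 Xx0] Xrun Xdown Xdir] := idX.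
have [V pV Vmax] := maximal_pumpable p X; have [rV XV] := pV.
have Vpow n := run_pow n rV.
have EV : target p V = p by case/andP: rV => _ /eqP.
(* Colors a run by its first transition outside [V], or by [None]. The case [Some e] is stated up to
   embedding, so that the property passes to smaller runs. *)
pose F (o : option edge) x := if o is Some e then e \notin V /\ exists y z,
    [/\ {subset y <= V}, X (y ++ e :: z) & subseq x (y ++ e :: z)]
  else {subset x <= V}.
have [o oP] : exists o, forall x, X x -> F o x.
  apply: directed_pigeonhole => //; first by exists x0.
    move=> [e|] x y Xx xy /=.
      move=> [eV [y' [z [? ? ?]]]]; split=> //; exists y', z; split=> //.
      exact: subseq_trans xy _.
    by move=> yV a /(mem_subseq xy)/yV.
  move=> x Xx; case: (boolP (all (mem V) x)) => [/allP xV | ]; first by exists None.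
  rewrite -has_predC => /has_split[y [e [z [def_x]]]].
  rewrite has_predC negbK => /allP yV eV; exists (Some e); split=> //.
  by exists y, z; rewrite -def_x.
case: o oP => [e | ] oP /=.
  have eV : e \notin V by case: (oP _ Xx0).
  have XF x (Xx : X x) := proj2 (oP x Xx).
  set X' := residual X V e.
  have idX' : ideal_of_runs e.2 q X' by apply: ideal_residual idX eV XF.
  have [[z0 [y0 [y0V Xy0]]] X'run _ _] := idX'.
  have [ry0 re _] := run_cat_cons (Xrun _ Xy0).
  (* One prefix [y0] serves all tails: [size y0] copies of [V] absorb [y0], the other [n] give the
     power, and the original prefix [y] is dropped. *)
  have X'X n z : X' z -> X (pow n V ++ y0 ++ e :: z).
    move=> X'z; have [y [yV Xyz]] := X'z.
    apply: Xdown (pumpable_pow (n + size y0) pV Xyz) _ _.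
      exact: run_cat (Vpow n) (run_cat ry0 (run_cat re (X'run _ X'z))).
    rewrite /pow nseqD flatten_cat -catA; apply: cat_subseq => //.
    apply: cat_subseq; first exact: subset_subseq_pow.
    exact: suffix_subseq.
  (* Conversely, the prefix [y] of a run is absorbed by [size y] copies of [V]. *)
  have XX' x : X x -> exists n z, X' z /\ subseq x (pow n V ++ y0 ++ e :: z).
    move=> /XF[y [z [yV Xyz xyz]]]; exists (size y), z; split; first by exists y.
    apply: subseq_trans xyz _; apply: cat_subseq; first exact: subset_subseq_pow.
    exact: suffix_subseq.
  have ltJ : proper_downset (closure X') J.
    rewrite -defJ; split.
    - by move=> x y [z Xz yz] xy; exists z => //; apply: subseq_trans xy yz.
    - move=> x [z [y [_ Xyz]] xz]; exists (y ++ e :: z) => //.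
      apply: subseq_trans xz _; rewrite -cat_rcons; exact: suffix_subseq.
    (* Otherwise every run of [X] embeds in a tail, which yields a pumpable loop through [e] and
       contradicts the maximality of [V]. *)
    apply: NNPP => eqJ; have XcX' x : X x -> closure X' x.
      move=> Xx; apply: NNPP => nX'; apply: eqJ; exists x => //.
      by exists x.
    have [v pv ev] : exists2 v, pumpable p X v & e \in v.
      apply: uniform_pumpable idX _ => x Xx; have [z X'z xz] := XcX' _ Xx.
      have rx := Xrun _ Xx; have rz := X'run _ X'z.
      (* Cut [z] just before the match of the first edge of [x]. As [x] starts at [p], the piece [t]
         leads back to [p]; if [x] is empty, then [p = q] and [t] is all of [z]. *)
      have [t [x' [def_z rt xx']]] : exists t x', [/\ z = t ++ x', run e.2 p t & subseq x x'].
        case: x rx xz {Xx} => [|a x].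
          by rewrite run_nil => /eqP->; exists z, [::]; rewrite cats0.
        rewrite run_cons => /and3P[/eqP Ea _ _] /subseq_consP[t [x' [def_z xx']]].
        exists t, (a :: x'); rewrite /= eqxx -Ea; split=> //.
        by move: rz; rewrite def_z => /run_cat_cons[].
      have rv : run p p (y0 ++ e :: t) by apply: run_cat ry0 (run_cat re rt).
      exists (y0 ++ e :: t); split=> //; first by rewrite mem_cat mem_head orbT.
      apply: Xdown (X'X 0 _ X'z) (run_cat rv rx) _.
      by rewrite def_z /= -!catA /=; apply: cat_subseq => //=; rewrite eqxx; apply: cat_subseq.
    by case/negP: eV; apply: Vmax pv _ ev.
  have [[u l] [/andP[rP lo] PX']] := IH _ ltJ _ _ erefl idX'.
  (* Prepends [V^* y0 e] to the pattern of the residual. *)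
  exists ([::], (V, y0 ++ e :: u) :: l); split.
    rewrite /run_pattern; have -> : pat_word ([::], (V, y0 ++ e :: u) :: l)
        = V ++ y0 ++ [:: e] ++ pat_word (u, l) by rewrite /pat_word /= -!catA.
    rewrite (run_cat rV (run_cat ry0 (run_cat re rP))) /= EV eqxx /=.
    by case/andP: (run_cat ry0 re) => _ /eqP E; rewrite -cat_rcons target_cat -cats1 E.
  have langP y : pat_lang ([::], (V, y0 ++ e :: u) :: l) y <->
      exists n z, pat_lang (u, l) z /\ y = pow n V ++ y0 ++ e :: z.
    rewrite pat_lang_cons -cat_rcons.
    split=> [[n [_ [/pat_lang_catl[z [lz ->]] ->]]] | [n [z [lz ->]]]].
      by exists n, z; rewrite cat_rcons.
    exists n, (y0 ++ e :: z); split=> //; apply/pat_lang_catl.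
    by exists z; rewrite cat_rcons.
  move=> x; split=> [Xx | [rx [y [/langP[n [z [lz ->]]] xy]]]].
    split; first exact: Xrun.
    have [n [z [/PX'[_ [z' [lz' zz']]] xz]]] := XX' _ Xx.
    exists (pow n V ++ y0 ++ e :: z'); split; first by apply/langP; exists n, z'.
    by apply: subseq_trans xz _; do 2 apply: cat_subseq => //; rewrite /= eqxx.
  apply: Xdown (X'X n z _) rx xy; apply/PX'; split; last by exists z.
  by apply: run_pat_lang lz; rewrite /run_pattern rP.
(* All runs of [X] are over [V], so each [x] embeds in [size x] copies of [V]; the suffix [x0] leads
   from [p] to [q]. *)
exists ([::], [:: (V, x0)]); split.
  by rewrite /run_pattern /pat_word /= cats0 EV eqxx (run_cat rV (Xrun _ Xx0)).
move=> x; split=> [Xx | [rx [y [/pat_lang_cons[n [_ [/pat_lang_nil-> ->]]] xy]]]].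
  split; first exact: Xrun.
  exists (pow (size x) V ++ x0); split.
    by apply/pat_lang_cons; exists (size x), x0; split=> //; apply/pat_lang_nil.
  exact: subseq_trans (subset_subseq_pow (oP _ Xx)) (prefix_subseq _ _).
exact: Xdown (pumpable_pow n pV Xx0) rx xy.
Qed.

(** The piece skipped before a matched edge leads from the current state to the source of that edge,
    which is the same state; the piece after the last match leads from [q] to [q]. *)
Lemma subseq_run_pattern p q x y : run p q x -> run p q y -> subseq x y ->
  exists P, [/\ run_pattern p q P, pat_erase P = x & pat_word P = y].
Proof.
elim: x p y => [|e x IH] p y rx ry.
  move: rx ry; rewrite run_nil => /eqP<- ry _; exists ([::], [:: (y, [::])]).
  rewrite /run_pattern /pat_word /pat_erase /= !cats0 ry.
  by case/andP: ry => _ /eqP->; rewrite eqxx.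
move: rx; rewrite run_cons => /and3P[/eqP Ee _ rx].
move=> /subseq_consP[y1 [y2 [def_y xy2]]]; rewrite {y}def_y in ry *.
have [ry1 re ry2] := run_cat_cons ry; rewrite Ee in ry1 re.
have [[u l] [/andP[rP lo] eP wP]] := IH _ _ rx ry2 xy2.
exists ([::], (y1, e :: u) :: l); split; first last.
- by rewrite -wP /pat_word /= -catA.
- by rewrite -eP.
rewrite /run_pattern; have -> : pat_word ([::], (y1, e :: u) :: l)
    = y1 ++ [:: e] ++ pat_word (u, l) by rewrite /pat_word /= -catA.
rewrite (run_cat ry1 (run_cat re rP)) /=; case/andP: ry1 => _ /eqP->.
by rewrite eqxx.
Qed.

(** * Labels of runs and of patterns *)

Definition label x : seq Sigma := [seq e.1.2 | e <- x].
Definition targets x : seq Q := [seq e.2 | e <- x].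

Definition label_pattern P : pattern Sigma :=
  (label P.1, [seq (label vu.1, label vu.2) | vu <- P.2]).

Lemma label_cat x y : label (x ++ y) = label x ++ label y.
Proof. exact: map_cat. Qed.

Lemma label_pow n v : label (pow n v) = pow n (label v).
Proof. by elim: n => //= n IH; rewrite /pow /= label_cat -/(pow n v) IH. Qed.

Lemma label_pat_word P : label (pat_word P) = pat_word (label_pattern P).
Proof.
case: P => u l; rewrite /pat_word label_cat /=; congr (_ ++ _).
by elim: l => //= [[v u'] l IH]; rewrite !label_cat IH.
Qed.

Lemma label_pat_erase P : label (pat_erase P) = pat_erase (label_pattern P).
Proof.
case: P => u l; rewrite /pat_erase label_cat /=; congr (_ ++ _).
by elim: l => //= [[v u'] l IH]; rewrite !label_cat IH.
Qed.

Lemma label_pat_lang P (w : seq Sigma) :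
  pat_lang (label_pattern P) w <-> exists2 y, pat_lang P y & label y = w.
Proof.
case: P => u l; elim: l u w => [|[v u'] l IH] u w.
  split=> [/pat_lang_nil-> | [y /pat_lang_nil-> <-]]; last exact/pat_lang_nil.
  by exists u => //; apply/pat_lang_nil.
split=> [/pat_lang_cons[n [z [/(IH u')[y ly <-] ->]]] | [y /pat_lang_cons[n [z [lz ->]]] <-]].
  exists (u ++ pow n v ++ y); first by apply/pat_lang_cons; exists n, y.
  by rewrite !label_cat label_pow.
apply/pat_lang_cons; exists n, (label z); rewrite !label_cat label_pow.
by split=> //; apply/(IH u'); exists z.
Qed.

(** Cut the run at the lengths of the factors of its label. *)
Lemma lift_pattern (P' : pattern Sigma) x : label x = pat_word P' ->
  exists2 P, label_pattern P = P' & pat_word P = x.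
Proof.
have split_label y (w1 w2 : seq Sigma) : label y = w1 ++ w2 ->
    exists y1 y2, [/\ y = y1 ++ y2, label y1 = w1 & label y2 = w2].
  move=> Ey; exists (take (size w1) y), (drop (size w1) y).
  by rewrite cat_take_drop /label map_take map_drop -/(label y) Ey take_size_cat ?drop_size_cat.
case: P' => u l; elim: l u x => [|[v u'] l IH] u x /=.
  by rewrite /pat_word /= cats0 => <-; exists (x, [::]) => //; rewrite /pat_word /= cats0.
rewrite /pat_word /= -catA => /split_label[x1 [x2 [-> <- /split_label[x3 [x4 [-> <- /(IH u')]]]]]].
move=> [[u1 l1] [<- <-] <-]; exists (x1, (x3, u1) :: l1) => //.
by rewrite /pat_word /= -catA.
Qed.

Lemma nth_targets r p x k : k <= size x ->
  nth r (p :: targets x) k = target p (take k x).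
Proof. by elim: x p k => [|e x IH] p [|k] //= kx; rewrite IH. Qed.

(** Absorbing the first loop into the prefix leaves all later positions unchanged, which makes the
    positional condition accessible to induction. *)
Lemma loops_ok_cons (u v u' : seq Sigma) l q rs :
  loops_ok (u, (v, u') :: l) q rs <->
  nth q (q :: rs) (size u) = nth q (q :: rs) (size u + size v)
    /\ loops_ok (u ++ v ++ u', l) q rs.
Proof.
have startS i : pat_start (u, (v, u') :: l) i.+1 = pat_start (u ++ v ++ u', l) i.
  by rewrite /pat_start /= -!catA.
split=> [H | [H0 H]].
  split; first by have := H 0 isT; rewrite /pat_start /= cats0.
  by move=> i il; have := H i.+1 il; rewrite startS.
by case=> [|i] il; [rewrite /pat_start /= cats0 | rewrite startS; apply: H].
Qed.

Lemma loops_okP p P :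
  loops_ok (label_pattern P) p (targets (pat_word P)) <-> looped (target p P.1) P.2.
Proof.
case: P => u l; elim: l u => [|[v u'] l IH] u //=.
have -> : pat_word (u, (v, u') :: l) = pat_word (u ++ v ++ u', l).
  by rewrite /pat_word /= -!catA.
rewrite /label_pattern /= loops_ok_cons -!label_cat.
have {}IH := IH (u ++ v ++ u'); rewrite /label_pattern /= in IH; rewrite {}IH.
rewrite /label !size_map !nth_targets; first last.
- by rewrite /pat_word /= !size_cat -addnA leq_addr.
- by rewrite /pat_word /= !size_cat -!addnA leq_add2l leq_addr.
have -> : pat_word (u ++ v ++ u', l) = u ++ v ++ u' ++ flatten [seq vu.1 ++ vu.2 | vu <- l].
  by rewrite /pat_word /= -!catA.
rewrite take_size_cat // catA -size_cat take_size_cat // !target_cat.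
by split=> [[<- ->] | /andP[/eqP-> ->]]; rewrite ?eqxx.
Qed.

(** * Accepting runs and the order on words *)

Definition accepting p q x := [&& init A p, final A q & run p q x].

Lemma accepting_runP p rs (w : seq Sigma) : accepting_run A p rs w <->
  exists q x, [/\ accepting p q x, label x = w & targets x = rs].
Proof.
rewrite /accepting_run /accepting; split=> [/and3P[Ip walk_rs Fq] | ].
  have [x [wx lx tx]] : exists x, [/\ walk p x, label x = w & targets x = rs].
    elim: w p rs {Ip Fq} walk_rs => [|a w IH] p [|r rs] //=.
      by exists [::].
    move=> /andP[tr /IH[x [wx lx tx]]]; exists ((p, a, r) :: x).
    by rewrite /= eqxx tr wx lx tx.
  exists (last p rs), x; split=> //; rewrite Ip Fq /run wx /target.
  by rewrite -tx eqxx.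
move=> [q [x [/and3P[Ip Fq /andP[wx /eqP Eq]] <- <-]]]; rewrite Ip.
rewrite /target -/(targets x) in Eq; rewrite Eq Fq andbT /= {Ip Eq}.
elim: x p wx => //= e x IH p /and3P[/eqP _ -> wx]; exact: IH.
Qed.

Lemma loop_patternP (P' : pattern Sigma) : loop_pattern A P' <->
  exists p q P, [/\ init A p, final A q, run_pattern p q P & label_pattern P = P'].
Proof.
split=> [[p [rs [/accepting_runP[q [x [/and3P[Ip Fq rx] lx <-]]] lo]]] |
         [p [q [P [Ip Fq /andP[rP lo] <-]]]]].
  have [P def_P wP] := lift_pattern lx; exists p, q, P; split=> //.
  by rewrite /run_pattern wP rx; apply/loops_okP; rewrite def_P wP.
exists p, (targets (pat_word P)); split; last exact/loops_okP.
apply/accepting_runP; exists q, (pat_word P); split=> //; last exact: label_pat_word.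
by rewrite /accepting Ip Fq.
Qed.

(** Erasing the loops is the case where all exponents are zero. *)
Lemma run_pattern_erase p q P : run_pattern p q P -> run p q (pat_erase P).
Proof.
move=> rP; apply: (run_pat_lang rP); exists (nseq (size P.2) 0).
rewrite size_nseq; split=> //; rewrite /pat_erase; congr (_ ++ _).
by elim: P.2 => //= vu l ->.
Qed.

Lemma subseq_erase_word P : subseq (pat_erase P) (pat_word P).
Proof.
apply: cat_subseq => //; elim: P.2 => //= [[v u] l IH] /=.
by apply: cat_subseq => //; apply: suffix_subseq.
Qed.

(** Erasing loops leaves a subsequence that is a run between the same states; conversely,
    [subseq_run_pattern] exhibits the skipped pieces as loops. *)
Lemma preceqP (u v : seq Sigma) : preceq A u v <-> exists p q x y,
  [/\ accepting p q x, accepting p q y, label x = u, label y = v & subseq x y].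
Proof.
split=> [[_ [<- [<- /loop_patternP[p [q [P [Ip Fq rP <-]]]]]]] | ].
  exists p, q, (pat_erase P), (pat_word P).
  rewrite /accepting Ip Fq (run_pattern_erase rP) label_pat_erase label_pat_word.
  by split=> //; [case/andP: rP | apply: subseq_erase_word].
move=> [p [q [x [y [/and3P[Ip Fq rx] /and3P[_ _ ry] <- <- xy]]]]].
have [P [rP <- <-]] := subseq_run_pattern rx ry xy.
exists (label_pattern P); rewrite label_pat_erase label_pat_word; do 2 split=> //.
by apply/loop_patternP; exists p, q, P.
Qed.

(** * Ideals of words for a labeling automaton *)

Hypothesis labA : labeling A.

Lemma accepting_exists (w : seq Sigma) : exists p q x, accepting p q x /\ label x = w.
Proof.
have [[p rs] [/accepting_runP[q [x [ax lx _]]] _]] := labA w.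
by exists p, q, x.
Qed.

Lemma accepting_inj p q x p' q' x' : accepting p q x -> accepting p' q' x' ->
  label x = label x' -> [/\ p = p', q = q' & x = x'].
Proof.
move=> ax ax' Exx'.
have [pr [_ uniq_run]] := labA (label x).
have E1 : pr = (p, targets x).
  by apply: uniq_run; apply/accepting_runP; exists q, x.
have E2 : pr = (p', targets x').
  by apply: uniq_run; rewrite /= Exx'; apply/accepting_runP; exists q', x'.
have {pr uniq_run E1 E2} [Ep Et] : (p', targets x') = (p, targets x) by rewrite -E1.
rewrite {p'}Ep in ax' *.
case/and3P: ax => _ _ rx; case/and3P: ax' => _ _ rx'.
(* The source of each edge is the preceding target, so equal start, labels and targets give equal
   edges. *)
have Ex : x = x'.
  elim: x p x' rx rx' Exx' Et => [|[[p1 a] r] x IH] p [|[[p1' a'] r'] x'] //=.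
  rewrite !run_cons /= => /and3P[/eqP-> _ rx] /and3P[/eqP-> _ rx'] [<- Exx'] [Er Et].
  by rewrite Er in rx' *; rewrite (IH r x').
by split=> //; apply: run_target rx _; rewrite Ex.
Qed.

(** By uniqueness of the run on [label y], the endpoints and the larger run produced by [preceqP]
    are [p], [q] and [y]. *)
Lemma preceq_label p q y (u : seq Sigma) : accepting p q y ->
  preceq A u (label y) <-> exists x, [/\ run p q x, label x = u & subseq x y].
Proof.
move=> ay; split=> [/preceqP[p' [q' [x [y' [/and3P[_ _ rx] ay' lx ly xy]]]]] | [x [rx lx xy]]].
  by exists x; have [<- <- <-] := accepting_inj ay' ay ly.
apply/preceqP; exists p, q, x, y; split=> //.
by case/and3P: ay => Ip Fq _; apply/and3P.
Qed.

Lemma label_preceq p q x (v : seq Sigma) : accepting p q x ->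
  preceq A (label x) v <-> exists y, [/\ run p q y, label y = v & subseq x y].
Proof.
move=> ax; split=> [/preceqP[p' [q' [x' [y [ax' /and3P[_ _ ry] lx ly xy]]]]] | [y [ry ly xy]]].
  by exists y; have [<- <- <-] := accepting_inj ax' ax lx.
apply/preceqP; exists p, q, x, y; split=> //.
by case/and3P: ax => Ip Fq _; apply/and3P.
Qed.

Lemma down_pat_langP p q P (w : seq Sigma) : init A p -> final A q -> run_pattern p q P ->
  down A (pat_lang (label_pattern P)) w <->
  exists x, [/\ run p q x, label x = w & exists y, pat_lang P y /\ subseq x y].
Proof.
move=> Ip Fq rP.
have acc y : pat_lang P y -> accepting p q y.
  by move=> /(run_pat_lang rP) ry; apply/and3P.
split=> [[_ [/label_pat_lang[y ly <-] /(preceq_label _ (acc _ ly))[x [rx lx xy]]]] | ].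
  by exists x; split=> //; exists y.
move=> [x [rx lx [y [ly xy]]]]; exists (label y); split.
  by apply/label_pat_lang; exists y.
by apply/(preceq_label _ (acc _ ly)); exists x.
Qed.

(** Two runs below members of the pattern language are bounded by a common upper bound of these
    members within the language. *)
Lemma ideal_down_pat_lang p q P : init A p -> final A q -> run_pattern p q P ->
  ideal A (down A (pat_lang (label_pattern P))).
Proof.
move=> Ip Fq rP; have acc x : run p q x -> accepting p q x by move=> rx; apply/and3P.
have downP (u : seq Sigma) := down_pat_langP u Ip Fq rP; split.
- have [y ly] := pat_lang_inhabited P; exists (label y); apply/downP; exists y.
  by split=> //; [apply: run_pat_lang ly | exists y].
- move=> w w' /downP[x [rx <- [y [ly xy]]]] /(preceq_label _ (acc _ rx))[x' [rx' lx' x'x]].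
  by apply/downP; exists x'; split=> //; exists y; split=> //; apply: subseq_trans xy.
move=> w w' /downP[x [rx <- [y [ly xy]]]] /downP[x' [rx' <- [y' [ly' xy']]]].
have [z [lz yz yz']] := pat_lang_directed ly ly'; have rz := run_pat_lang rP lz.
exists (label z); split.
- by apply/downP; exists z; split=> //; exists z.
- by apply/(preceq_label _ (acc _ rz)); exists x; split=> //; apply: subseq_trans yz.
by apply/(preceq_label _ (acc _ rz)); exists x'; split=> //; apply: subseq_trans yz'.
Qed.

(** Each word of [S] has with a fixed [w0] a common upper bound in [S]; the run of that bound has
    the endpoints of the run of [w0], hence so has the run of the word. *)
Lemma ideal_runs (S : seq Sigma -> Prop) : ideal A S -> exists p q,
  [/\ init A p, final A q, ideal_of_runs p q (fun x => run p q x /\ S (label x))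
    & forall u, S u -> exists2 x, run p q x & label x = u].
Proof.
move=> [[w0 Sw0] Sdown Sdir].
have [p [q [x0 [ax0 lx0]]]] := accepting_exists w0; rewrite -lx0 in Sw0 *.
have [Ip Fq rx0] := and3P ax0.
have acc x : run p q x -> accepting p q x by move=> rx; apply/and3P.
exists p, q; split=> //; first split.
- by exists x0.
- by move=> x [].
- move=> x y [ry Sy] rx xy; split=> //; apply: Sdown Sy _.
  by apply/(preceq_label _ (acc _ ry)); exists x.
- move=> x y [rx Sx] [ry Sy]; have [w [Sw]] := Sdir _ _ Sx Sy.
  move=> /(label_preceq _ (acc _ rx))[z [rz lz xz]].
  move=> /(label_preceq _ (acc _ ry))[z' [rz' lz' yz']].
  (* Both runs carry the label [w], so they coincide. *)
  have [_ _ Ez] : [/\ p = p, q = q & z = z'].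
    by apply: accepting_inj; rewrite ?lz ?lz'; auto.
  by exists z; rewrite lz Ez; split=> //; rewrite -Ez.
move=> w Sw; have [w' [Sw' /(label_preceq _ ax0)[y [ry <- _]]]] := Sdir _ _ Sw0 Sw.
by move=> /(preceq_label _ (acc _ ry))[x [rx lx _]]; exists x.
Qed.

End Runs.

Theorem mainTheorem12 (Sigma Q : finType) (A : automaton Sigma Q) :
  labeling A ->
  forall S : seq Sigma -> Prop,
    ideal A S <->
    exists p : pattern Sigma,
      loop_pattern A p /\ (forall w, S w <-> down A (pat_lang p) w).
Proof.
move=> labA S; split=> [/(ideal_runs labA)[p [q [Ip Fq idX SX]]] | ].
  have [P [rP XP]] := ideal_of_runs_pattern idX.
  exists (label_pattern P); split; first by apply/loop_patternP; exists p, q, P.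
  move=> w; rewrite (down_pat_langP labA w Ip Fq rP); split.
    move=> Sw; have [x rx lx] := SX _ Sw; exists x; split=> //.
    by have /XP[] : run A p q x /\ S (label x) by rewrite lx.
  by move=> [x [rx <- yP]]; have [_] : run A p q x /\ S (label x) by apply/XP.
move=> [_ [/loop_patternP[p [q [P [Ip Fq rP <-]]]] SP]].
have [[w0 /SP Sw0] down_cl dir] := ideal_down_pat_lang labA Ip Fq rP.
split; first by exists w0.
- by move=> w w' /SP Dw' /(down_cl _ _ Dw')/SP.
move=> w w' /SP Dw /SP Dw'; have [z [/SP Sz wz wz']] := dir _ _ Dw Dw'.
by exists z.
Qed.
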